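(* (1) For every positive integer $n$, $A_n \subseteq \{d>0 : d^2 \in \mathbb{Q}\}$. (2) For every integer $n \geq 2$, $D_n$ is a dense subset of $(0,\infty)$.
   Context: Define $\varphi_n:\mathbb{C}^n\times\mathbb{C}^n\to\mathbb{C}$ by $\varphi_n((x_1,\dots,x_n),(y_1,\dots,y_n))=(x_1-y_1)^2+\dots+(x_n-y_n)^2$ (no complex conjugation or absolute values). $\mathbb{R}^n$ is regarded as a subset of $\mathbb{C}^n$, and $|\cdot|$ is the Euclidean norm on $\mathbb{R}^n$, so $\varphi_n(x,y)=|x-y|^2$ for $x,y\in\mathbb{R}^n$. For $S\subseteq\mathbb{R}^n$, a map $f:S\to\mathbb{C}^n$ preserves distance $d\ge 0$ if for all $x,y\in S$, $\varphi_n(x,y)=d^2$ implies $\varphi_n(f(x),f(y))=d^2$; it preserves unit distance if this holds with $d=1$. For $x,y\in S$, $f$ preserves the distance between $x$ and $y$ if $\varphi_n(f(x),f(y))=|x-y|^2$. $A_n$ denotes the set of all positive real numbers $d$ such that every map $f:\mathbb{R}^n\to\mathbb{C}^n$ that preserves unit distance also preserves distance $d$. $D_n$ denotes the set of all positive real numbers $d$ with the property: if $x,y\in\mathbb{R}^n$ and $|x-y|=d$, then there exists a finite set $S_{xy}$ with $\{x,y\}\subseteq S_{xy}\subseteq\mathbb{R}^n$ such that every map $f:S_{xy}\to\mathbb{C}^n$ that preserves unit distance also preserves the distance between $x$ and $y$. *)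

(* Defs.v *)
From HB Require Import structures.
From mathcomp Require Import all_boot all_order all_algebra.
From mathcomp Require Import complex.
From mathcomp Require Import all_classical all_reals all_analysis.
Set Implicit Arguments.
Unset Strict Implicit.
Unset Printing Implicit Defensive.
Import Order.TTheory GRing.Theory Num.Theory.
Import numFieldNormedType.Exports.
Local Open Scope classical_set_scope.
Local Open Scope complex_scope.
Local Open Scope ring_scope.

Section BeckmanQuarles.
Variables (R : realType) (n : nat).

(* A genuine sum of squares: no conjugation or modulus. *)
Definition phi (x y : 'rV[R[i]]_n) : R[i] := \sum_(k < n) (x 0 k - y 0 k) ^+ 2.

Definition toC (x : 'rV[R]_n) : 'rV[R[i]]_n := \row_k (x 0 k)%:C.

(* The Euclidean norm; the library's norm on row vectors is the sup norm. *)
Definition enorm (x : 'rV[R]_n) : R := Num.sqrt (\sum_(k < n) x 0 k ^+ 2).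

(* A map S -> C^n is represented by a total function on R^n of which only the
   values on S are used. *)
Definition preserves_dist (S : set 'rV[R]_n) (f : 'rV[R]_n -> 'rV[R[i]]_n)
    (d : R) : Prop :=
  forall x y, S x -> S y ->
    phi (toC x) (toC y) = (d ^+ 2)%:C -> phi (f x) (f y) = (d ^+ 2)%:C.

Definition preserves_unit_dist (S : set 'rV[R]_n)
    (f : 'rV[R]_n -> 'rV[R[i]]_n) : Prop := preserves_dist S f 1.

Definition preserves_dist_between (f : 'rV[R]_n -> 'rV[R[i]]_n)
    (x y : 'rV[R]_n) : Prop := phi (f x) (f y) = (enorm (x - y) ^+ 2)%:C.

Definition A_set : set R :=
  [set d | 0 < d /\
    forall f : 'rV[R]_n -> 'rV[R[i]]_n,
      preserves_unit_dist setT f -> preserves_dist setT f d].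

Definition D_set : set R :=
  [set d | 0 < d /\
    forall x y : 'rV[R]_n, enorm (x - y) = d ->
      exists Sxy : set 'rV[R]_n,
        [/\ finite_set Sxy, [set x; y] `<=` Sxy &
            forall f : 'rV[R]_n -> 'rV[R[i]]_n,
              preserves_unit_dist Sxy f -> preserves_dist_between f x y]].

End BeckmanQuarles.

Arguments A_set : clear implicits.
Arguments D_set : clear implicits.

(* Main.v *)
Require Import Defs.
From HB Require Import structures.
From mathcomp Require Import all_boot all_order all_algebra.
From mathcomp Require Import complex.
From mathcomp Require Import all_classical all_reals all_analysis.
From mathcomp Require Import ring lra.
Set Implicit Arguments.
Unset Strict Implicit.
Unset Printing Implicit Defensive.
Import Order.TTheory GRing.Theory Num.Theory.
Import numFieldNormedType.Exports.
Local Open Scope classical_set_scope.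
Local Open Scope complex_scope.
Local Open Scope ring_scope.

(** Rationality. A field endomorphism s of the complex numbers, applied to each
    coordinate, changes phi into s(phi), hence preserves unit distance; it does
    not preserve d as soon as s moves d^2. Every t that is not rational is moved
    by some s ([irrational_moved]): over a subfield K maximal among those not
    containing t, all complex numbers are algebraic and t has a conjugate
    t' <> t, so the isomorphism of K(t) onto K(t') fixing K extends to an
    endomorphism.

    Density. The set D_n is closed under products ([D_setM]), because a finite
    configuration can be enlarged by a factor already known to be preserved. So
    two elements u > 1 > w of D_n with no product u^i w^j equal to 1 suffice: a
    multiplicative semigroup with elements on both sides of 1 but without 1
    accumulates at 1 ([semigroup_near1]), hence is dense ([dense_semigroup]).

    The elements of D_n come from one configuration: two points x and y that are
    mirror images in the hyperplane of n points p_i. If the distances among the p_i and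
    from x to the p_i are preserved, linear algebra over the complex numbers
    leaves two possibilities, that the distance xy is preserved or that f merges
    x and y ([reflected_apex_image]). Merging is excluded by a third point at
    suitable distances from x and y ([exclude_merging]). With a regular simplex
    of edge e as base and legs a the distance obtained has square
    4 a^2 - (2 - 2/n) e^2 ([isosceles]). Starting from a = e = 1 this gives
    c with c^2 = 2 + 2/n, then, for n >= 3, an element w < 1 of the form
    (2/n) c^(2k) ([D_set_space]), and u = c^2. In the plane these values are
    integers, and one also reflects the triangle with sides 1, sqrt 3, sqrt 3 in
    a long side ([D_set_plane]). The required independence is that n + 1 is prime
    to n, respectively that 11 is prime to 3. *)

(** * Isomorphisms between subfields *)

(** The graph of an isomorphism between two subfields of F. Graphs are ordered by
    inclusion, so that extending an isomorphism is enlarging a set and Zorn's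
    lemma for sets applies; a subfield is a graph contained in the diagonal. *)
Record subiso (F : fieldType) := SubIso {
  graph : set (F * F);
  graph1 : graph 1;
  graphB : forall u v, graph u -> graph v -> graph (u - v);
  graphM : forall u v, graph u -> graph v -> graph (u * v);
  graph_inj : forall u, graph u -> u.1 = 0 \/ u.2 = 0 -> u = 0;
  graphV : forall u, graph u -> graph (u.1^-1, u.2^-1) }.

Section SubIsoField.
Variables (F : fieldType) (G : subiso F).

Definition graph_pred : pred (F * F) := fun u => `[< graph G u >].

Fact graph_subring : subring_closed graph_pred.
Proof.
split=> [|u v /asboolP Gu /asboolP Gv|u v /asboolP Gu /asboolP Gv].
- exact/asboolP/graph1.
- exact/asboolP/graphB.
- exact/asboolP/graphM.
Qed.

HB.instance Definition _ :=
  GRing.isSubringClosed.Build (F * F)%type graph_pred graph_subring.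

(** The subring of F * F whose carrier is the graph is a field: it is a copy of
    the source subfield that also knows the image of each of its elements. The
    polynomials over the source subfield are thus ordinary polynomials over
    elt, read in F through either of the two projections. *)
Record elt := Elt { elt_val : F * F; eltP : elt_val \in graph_pred }.

HB.instance Definition _ := [isSub for elt_val].
HB.instance Definition _ := [Choice of elt by <:].
HB.instance Definition _ := [SubChoice_isSubComNzRing of elt by <:].

Lemma graph_elt (a : elt) : graph G (val a). Proof. exact/asboolP/eltP. Qed.

Definition mk_elt u (Gu : graph G u) : elt := Elt (introT (asboolP _) Gu).

Definition elt_inv (a : elt) : elt := mk_elt (graphV (graph_elt a)).

Fact elt_mulVf (a : elt) : a != 0 -> elt_inv a * a = 1.
Proof.
move=> a0; apply: val_inj.
have an0 : val a <> 0 by move=> a_0; move/eqP: a0; apply; apply: val_inj.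
have [a1 a2] : (val a).1 != 0 /\ (val a).2 != 0.
  by split; apply/eqP => a_0; apply: an0; apply: graph_inj (graph_elt a) _;
    [left|right].
by apply: injective_projections; rewrite /= mulVf.
Qed.

Fact elt_inv0 : elt_inv 0 = 0.
Proof. by apply: val_inj => /=; rewrite /= invr0. Qed.

HB.instance Definition _ := GRing.ComNzRing_isField.Build elt elt_mulVf elt_inv0.

Definition src : elt -> F := fst \o val.
Definition tgt : elt -> F := snd \o val.
HB.instance Definition _ := GRing.RMorphism.on src.
HB.instance Definition _ := GRing.RMorphism.on tgt.

End SubIsoField.

(** An isomorphism extends by x |-> y exactly when x and y satisfy the same
    polynomial relations. The formula for the extension, on rational fractions
    in x, does not distinguish algebraic from transcendental x. *)
Section Extend.
Variables (F : fieldType) (G : subiso F) (x y : F).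
Hypothesis xy_compat : forall q : {poly elt G},
  (map_poly (@src F G) q).[x] = 0 <-> (map_poly (@tgt F G) q).[y] = 0.

Let e1 (q : {poly elt G}) : F := (map_poly (@src F G) q).[x].
Let e2 (q : {poly elt G}) : F := (map_poly (@tgt F G) q).[y].

Definition ext_graph : set (F * F) :=
  [set u | exists q r, e1 r != 0 /\ u = (e1 q / e1 r, e2 q / e2 r)].

Let e_one : (e1 1 = 1) * (e2 1 = 1).
Proof. by rewrite /e1 /e2 !rmorph1 !hornerC. Qed.

Let eB q r : (e1 (q - r) = e1 q - e1 r) * (e2 (q - r) = e2 q - e2 r).
Proof. by rewrite /e1 /e2 !rmorphB /= !hornerD !hornerN. Qed.

Let eM q r : (e1 (q * r) = e1 q * e1 r) * (e2 (q * r) = e2 q * e2 r).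
Proof. by rewrite /e1 /e2 !rmorphM /= !hornerM. Qed.

Let e_neq0 q : e1 q != 0 -> e2 q != 0.
Proof. by move=> q1; apply/eqP => /xy_compat/eqP; apply/negP. Qed.

Let ext_graph1 : ext_graph 1.
Proof. by exists 1, 1; rewrite !e_one /= !divr1; split => //; apply: oner_neq0. Qed.

Let ext_graphB u v : ext_graph u -> ext_graph v -> ext_graph (u - v).
Proof.
move=> [q [r [r1 ->]]] [q' [r' [r1' ->]]]; have [r2 r2'] := (e_neq0 r1, e_neq0 r1').
exists (q * r' - q' * r), (r * r'); rewrite !eB !eM /=; split.
  by rewrite mulf_neq0.
by congr pair; rewrite /= -mulNr addf_div // mulNr.
Qed.

Let ext_graphM u v : ext_graph u -> ext_graph v -> ext_graph (u * v).
Proof.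
move=> [q [r [r1 ->]]] [q' [r' [r1' ->]]]; have [r2 r2'] := (e_neq0 r1, e_neq0 r1').
exists (q * q'), (r * r'); rewrite !eM /=; split; first by rewrite mulf_neq0.
by congr pair; rewrite /= mulf_div.
Qed.

Let ext_graph_inj u : ext_graph u -> u.1 = 0 \/ u.2 = 0 -> u = 0.
Proof.
move=> [q [r [r1 ->]]] /=; have r2 := e_neq0 r1.
have q12 : e1 q = 0 <-> e2 q = 0 by apply: xy_compat.
move=> qr0; suff [q1 q2] : e1 q = 0 /\ e2 q = 0 by rewrite q1 q2 !mul0r.
by case: qr0 => /eqP; rewrite mulf_eq0 invr_eq0 1?(negPf r1) 1?(negPf r2) orbF
  => /eqP q0; split=> //; apply/q12.
Qed.

Let ext_graphV u : ext_graph u -> ext_graph (u.1^-1, u.2^-1).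
Proof.
move=> [q [r [r1 ->]]] /=; have r2 := e_neq0 r1.
have [q1|q1] := eqVneq (e1 q) 0; last by exists r, q; rewrite !invf_div.
have q2 : e2 q = 0 by apply/xy_compat.
exists q, r; split=> //; first by rewrite q1 q2 !mul0r invr0.
Qed.

Definition extend : subiso F :=
  SubIso ext_graph1 ext_graphB ext_graphM ext_graph_inj ext_graphV.

Let extend_poly q : graph extend (e1 q, e2 q).
Proof.
exists q, 1; rewrite e_one.1 e_one.2 !divr1.
by split; first exact: oner_neq0.
Qed.

Lemma extend_sub : graph G `<=` graph extend.
Proof.
move=> [a b] Gab; have := extend_poly (mk_elt Gab)%:P.
by rewrite /e1 /e2 map_polyC map_polyC hornerC hornerC.
Qed.

Lemma extend_mem : graph extend (x, y).
Proof. by have := extend_poly 'X; rewrite /e1 /e2 !map_polyX !hornerX. Qed.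

(** With the denominator cleared, this expresses an element of the source of the
    extension by polynomials in x: it is how algebraic relations are found. *)
Lemma extend_frac u : graph extend u ->
  exists q r : {poly elt G}, (map_poly (@src F G) r).[x] != 0 /\
    u.1 * (map_poly (@src F G) r).[x] = (map_poly (@src F G) q).[x].
Proof. by move=> [q [r [r0 ->]]]; exists q, r; rewrite /= divfK. Qed.

End Extend.

Section Maximal.
Variables (F : fieldType) (Z : set (F * F)) (G0 : subiso F).
Hypothesis G0Z : graph G0 `<=` Z.

(** The union of a chain of graphs is a graph because any two of its points lie
    in a common member. Adjoining G0 to every set makes the empty chain
    harmless. *)
Lemma maximal_subiso : exists G : subiso F,
  [/\ graph G0 `<=` graph G, graph G `<=` Z
    & forall H : subiso F, graph G `<=` graph H -> graph H `<=` Z ->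
      graph H `<=` graph G].
Proof.
pose P (A : set (F * F)) := exists2 G, graph G = graph G0 `|` A & graph G `<=` Z.
have [|A [[G GA GZ] Amax]] := @Zorn_bigcup _ P; last first.
  exists G; split=> // [|H GH HZ]; first by rewrite GA; apply: subsetUl.
  apply: contrapT => nHG; apply: (Amax (graph H)); last first.
    exists H => //; apply/esym/setUidPr.
    by apply: subset_trans GH; rewrite GA; apply: subsetUl.
  split; last by move=> HA; apply: nHG => u /HA Au; rewrite GA; right.
  by apply: subset_trans GH; rewrite GA; apply: subsetUr.
move=> Fa FaP Ftot; set U := \bigcup_(X in Fa) X.
have common u v : (graph G0 `|` U) u -> (graph G0 `|` U) v ->
  exists H : subiso F, [/\ graph H `<=` graph G0 `|` U, graph H u, graph H v
    & graph H `<=` Z].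
  have up A : Fa A -> exists H : subiso F,
      [/\ graph H `<=` graph G0 `|` U, graph G0 `<=` graph H, A `<=` graph H
        & graph H `<=` Z].
    move=> FA; have [H HA HZ] := FaP A FA; exists H; split=> //; rewrite HA.
    - by apply: setUS => w Aw; exists A.
    - exact: subsetUl.
    - exact: subsetUr.
  move=> [Gu|[A FA Au]] [Gv|[B FB Bv]].
  - by exists G0; split=> //; apply: subsetUl.
  - by have [H [? HG HB ?]] := up B FB; exists H; split=> //; [exact: HG|exact: HB].
  - by have [H [? HG HA ?]] := up A FA; exists H; split=> //; [exact: HA|exact: HG].
  - have [AB|BA] := Ftot A B FA FB.
      by have [H [? _ HB ?]] := up B FB; exists H; split=> //; [exact/HB/AB|exact: HB].
    by have [H [? _ HA ?]] := up A FA; exists H; split=> //; [exact: HA|exact/HA/BA].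
have U1 : (graph G0 `|` U) 1 by left; apply: graph1.
have UB u v : (graph G0 `|` U) u -> (graph G0 `|` U) v -> (graph G0 `|` U) (u - v).
  by move=> Uu Uv; have [H [HU Hu Hv _]] := common u v Uu Uv; apply/HU/graphB.
have UM u v : (graph G0 `|` U) u -> (graph G0 `|` U) v -> (graph G0 `|` U) (u * v).
  by move=> Uu Uv; have [H [HU Hu Hv _]] := common u v Uu Uv; apply/HU/graphM.
have Uinj u : (graph G0 `|` U) u -> u.1 = 0 \/ u.2 = 0 -> u = 0.
  by move=> Uu; have [H [_ Hu _ _]] := common u u Uu Uu; apply: (graph_inj Hu).
have UV u : (graph G0 `|` U) u -> (graph G0 `|` U) (u.1^-1, u.2^-1).
  by move=> Uu; have [H [HU Hu _ _]] := common u u Uu Uu; apply/HU/graphV.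
exists (SubIso U1 UB UM Uinj UV) => // u Uu.
by have [H [_ Hu _ HZ]] := common u u Uu Uu; apply: HZ.
Qed.

End Maximal.

(** * Irreducible polynomials and their roots *)

Section MinimalPolynomial.
Variables (L F : fieldType) (i : {rmorphism L -> F}).

(** A nonzero polynomial of least size vanishing at x has no proper factor, since
    one of the two factors would vanish at x. *)
Lemma algebraic_irreducible x : algebraicOver i x ->
  exists2 p, irreducible_poly p & root (map_poly i p) x.
Proof.
pose P n := `[< exists p : {poly L}, [/\ p != 0, root (map_poly i p) x & size p = n] >].
move=> [p0 p00 p0x]; have exP : exists n, P n.
  by exists (size p0); apply/asboolP; exists p0.
case: (ex_minnP exP) => n /asboolP[p [p_neq0 px <-]] pmin.
have {}pmin (q : {poly L}) : q != 0 -> (size q < size p)%N -> ~~ root (map_poly i q) x.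
  move=> q0; rewrite ltnNge; apply: contra => qx.
  by apply: pmin; apply/asboolP; exists q.
exists p => //; split.
  rewrite ltnNge; apply/negP => /size1_polyC pE; move: px.
  rewrite pE map_polyC rootC fmorph_eq0 => /eqP p00'.
  by move: p_neq0; rewrite pE p00' eqxx.
move=> q q1 qp; rewrite -dvdp_size_eqp // eqn_leq dvdp_leq //= leqNgt.
have [r pE] := dvdpP _ _ qp.
have /andP[r0 q0] : (r != 0) && (q != 0) by rewrite -negb_or -mulf_eq0 -pE.
apply/negP => qltp.
have rltp : (size r < size p)%N.
  rewrite pE size_mul // -(prednK (n := size q)) ?size_poly_gt0 // addnS /=.
  rewrite -[ltnLHS]addn0 ltn_add2l -subn1 subn_gt0 ltn_neqAle eq_sym q1.
  by rewrite size_poly_gt0.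
move: px; rewrite pE rmorphM rootM.
by rewrite (negPf (pmin _ r0 rltp)) (negPf (pmin _ q0 qltp)).
Qed.

(** An irreducible polynomial not dividing q is coprime to q, and a Bezout
    relation evaluated at a common root would read 0 = 1. Hence two roots of one
    irreducible polynomial satisfy the same polynomial relations. *)
Lemma irreducible_root_dvdp p x : irreducible_poly p -> root (map_poly i p) x ->
  forall q, (map_poly i q).[x] = 0 <-> p %| q.
Proof.
move=> p_irr px q; split=> [qx|/dvdpP[r ->]]; last first.
  by rewrite rmorphM hornerM (rootP px) mulr0.
apply: contrapT => /negP npq; have : coprimep p q.
  rewrite irreducible_poly_coprime //.
move=> /Bezout_eq1_coprimepP[[u v] /= uv1].
have /eqP := congr1 (fun r => (map_poly i r).[x]) uv1.
rewrite rmorphD !rmorphM rmorph1 hornerD !hornerM (rootP px) qx !mulr0 addr0.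
by rewrite hornerC eq_sym oner_eq0.
Qed.

End MinimalPolynomial.

(** The degree exceeds 1 because t is not in the base field, and t is a simple
    root because in characteristic 0 the derivative is nonzero of smaller size;
    the cofactor of X - t therefore has a root, different from t. *)
Lemma irreducible_other_root (L : fieldType) (C : numClosedFieldType)
    (i : {rmorphism L -> C}) p t :
  irreducible_poly p -> root (map_poly i p) t -> (forall a, i a <> t) ->
  exists2 t', root (map_poly i p) t' & t' != t.
Proof.
move=> p_irr pt tNi; have p0 := irredp_neq0 p_irr.
have [q pE] := factor_theorem _ _ pt.
have q0 : q != 0.
  by apply: contra_neq p0 => q0; apply/eqP; rewrite -(map_poly_eq0 i) pE q0 mul0r.
have [|/closed_rootP[t' qt']] := eqVneq (size q) 1%N.
  move=> q1; have sp : size p = 2%N.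
    by rewrite -(size_map_poly i) pE size_Mmonic ?monicXsubC // size_XsubC q1.
  (* a constant cofactor makes p linear, with its root in the base field *)
  case: (tNi (- p`_0 / p`_1)).
  have p1 : p`_1 != 0 by rewrite -[1%N]/(2%N.-1) -sp -lead_coefE lead_coef_eq0.
  move: pt; rewrite rootE horner_coef size_map_poly sp !big_ord_recl big_ord0.
  rewrite !coef_map /= expr0 mulr1 expr1 addr0 addrC addr_eq0 rmorphM rmorphN fmorphV.
  by move=> /eqP <-; rewrite mulrC mulKf // fmorph_eq0.
have pt' : root (map_poly i p) t' by rewrite pE rootM qt'.
exists t' => //; apply/eqP => t'E; rewrite t'E in qt'.
(* a double root t would make p divide its derivative *)
have /(irreducible_root_dvdp p_irr pt) : (map_poly i p^`()).[t] = 0.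
  rewrite -deriv_map pE derivM derivXsubC mulr1 hornerD hornerM hornerXsubC.
  by rewrite subrr mulr0 add0r (rootP qt').
have sp : (1 < size p)%N := p_irr.1.
have dp0 : p^`() != 0.
  apply/eqP => /polyP/(_ (size p).-2); rewrite coef_deriv coef0.
  have -> : (size p).-2.+1 = (size p).-1 by case: (size p) sp => [|[]].
  move=> /(congr1 i)/eqP; rewrite -lead_coefE rmorphMn rmorph0 mulrn_eq0.
  rewrite fmorph_eq0 lead_coef_eq0 (negPf p0) orbF.
  by case: (size p) sp => [|[]].
move=> /dvdp_leq -/(_ dp0); rewrite leqNgt => /negP; apply.
exact: lt_size_deriv.
Qed.

(** * Endomorphisms moving an irrational number *)

Section RationalDiagonal.
Variable C : numFieldType.

Let ratC (q : rat) : C := ratr q.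
Definition rat_graph : set (C * C) := [set u | exists q, u = (ratC q, ratC q)].

Let rat_graph1 : rat_graph 1.
Proof. by exists 1; rewrite /ratC rmorph1. Qed.

Let rat_graphB u v : rat_graph u -> rat_graph v -> rat_graph (u - v).
Proof. by move=> [p ->] [q ->]; exists (p - q); rewrite /ratC rmorphB. Qed.

Let rat_graphM u v : rat_graph u -> rat_graph v -> rat_graph (u * v).
Proof. by move=> [p ->] [q ->]; exists (p * q); rewrite /ratC rmorphM. Qed.

Let rat_graph_inj u : rat_graph u -> u.1 = 0 \/ u.2 = 0 -> u = 0.
Proof. by move=> [q ->] /= [] ->. Qed.

Let rat_graphV u : rat_graph u -> rat_graph (u.1^-1, u.2^-1).
Proof. by move=> [q ->]; exists q^-1; rewrite /ratC fmorphV. Qed.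

Definition rat_diag : subiso C :=
  SubIso rat_graph1 rat_graphB rat_graphM rat_graph_inj rat_graphV.

End RationalDiagonal.

(** K is a subfield maximal among those not containing t. Every x outside K
    satisfies t = q(x) / r(x) with q and r over K, since K(x) contains t. This
    forces F to be algebraic over K, so that extending an embedding of K to F
    never meets a transcendental element. *)
Section AvoidingField.
Variables (F : fieldType) (t : F) (K : subiso F).
Hypothesis K_avoids : graph K `<=` [set u | u.1 = u.2 /\ u.1 <> t].
Hypothesis K_max : forall H : subiso F, graph K `<=` graph H ->
  graph H `<=` [set u | u.1 = u.2 /\ u.1 <> t] -> graph H `<=` graph K.

Let src_tgt : @src F K =1 @tgt F K.
Proof. by move=> a; have [] := K_avoids (graph_elt a). Qed.

Let src_neq_t a : @src F K a <> t.
Proof. by have [] := K_avoids (graph_elt a). Qed.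

Let fraction_or_mem x : (exists a, @src F K a = x) \/
  exists q r : {poly elt K}, (map_poly (@src F K) r).[x] != 0 /\
    t * (map_poly (@src F K) r).[x] = (map_poly (@src F K) q).[x].
Proof.
have xx_compat q : (map_poly (@src F K) q).[x] = 0 <-> (map_poly (@tgt F K) q).[x] = 0.
  by rewrite (eq_map_poly src_tgt).
have [|no_t] := pselect (exists2 u, graph (extend xx_compat) u & u.1 = t).
  by move=> [u Hu <-]; right; apply: extend_frac Hu.
have HZ : graph (extend xx_compat) `<=` [set u | u.1 = u.2 /\ u.1 <> t].
  move=> u Hu; split; last by move=> ut; apply: no_t; exists u.
  by have [q [r [_ ->]]] := Hu; rewrite /= !(eq_map_poly src_tgt).
have Kxx : graph K (x, x) := K_max (@extend_sub _ _ _ _ xx_compat) HZ (extend_mem _).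
by left; exists (mk_elt Kxx).
Qed.

(** Taking x = t ^ 2 turns t = q(x) / r(x) into the relation
    t r(t^2) = q(t^2). *)
Lemma avoided_algebraic : algebraicOver (@src F K) t.
Proof.
have [[a a_t2]|[q [r [r0 tr]]]] := fraction_or_mem (t ^+ 2).
  exists ('X^2 - a%:P).
    by rewrite -size_poly_eq0 size_XnsubC.
  rewrite rmorphB /= map_polyXn map_polyC rootE !hornerE.
  by rewrite [X in _ - X]a_t2 subrr.
exists ((r \Po 'X^2) * 'X - (q \Po 'X^2)).
  (* the two terms have opposite parity, so that the top coefficient of r survives *)
  apply/eqP => /polyP/(_ ((size r).-1.*2.+1)).
  rewrite coefB coefMX /= !coef_comp_poly_Xn // -!muln2 dvdn_mull // mulnK // coef0.
  rewrite dvdn2 /= muln2 odd_double subr0.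
  move=> /eqP; rewrite -lead_coefE lead_coef_eq0 => /eqP r_eq0.
  by move: r0; rewrite r_eq0 rmorph0 horner0 eqxx.
rewrite rootE rmorphB rmorphM /= !map_comp_poly map_polyXn map_polyX.
by rewrite !hornerE !horner_comp !hornerXn mulrC tr subrr.
Qed.

(** The relation t r(x) = q(x) is a polynomial equation for x over K(t), which is
    itself algebraic over K. *)
Lemma algebraic_over_avoiding x : algebraicOver (@src F K) x.
Proof.
have [[a <-]|[q [r [r0 tr]]]] := fraction_or_mem x; first exact: algebraic_id.
have /integral_algebraic t_int := avoided_algebraic.
apply/integral_algebraic.
apply: (@integral_root _ _ _ (t *: map_poly (@src F K) r - map_poly (@src F K) q)).
(* if t r = q as polynomials, comparing coefficients puts t in K *)
- apply/eqP => /polyP trq.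
  have [k rk] : exists k, r`_k != 0.
    exists (size r).-1; rewrite -lead_coefE lead_coef_eq0.
    by apply: contra_neq r0 => ->; rewrite rmorph0 horner0.
  apply: (@src_neq_t (q`_k / r`_k)).
  have /eqP := trq k; rewrite coefB coefZ !coef_map coef0 subr_eq0 => /eqP tr_k.
  have srk : @src F K r`_k != 0 by rewrite fmorph_eq0.
  by apply: (mulIf srk); rewrite [RHS]tr_k -rmorphM divfK.
- by rewrite rootE !hornerE tr subrr.
- apply/integral_poly => k; rewrite coefB coefZ !coef_map.
  by apply: integral_sub; [apply: integral_mul => //|]; apply: integral_id.
Qed.

End AvoidingField.

(** A graph with full source is the graph of a function, because a pair (0, y)
    in it has y = 0. *)
Lemma subiso_total_morphism (F : fieldType) (G : subiso F) :
  (forall x, exists y, graph G (x, y)) ->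
  exists s : {rmorphism F -> F}, forall x y, graph G (x, y) -> s x = y.
Proof.
move=> Gtotal; have [s sG] := choice Gtotal.
have Gfun x y z : graph G (x, y) -> graph G (x, z) -> y = z.
  move=> Gy Gz; have := graph_inj (graphB Gy Gz) => /= yz.
  have /(congr1 snd)/= := yz (or_introl (subrr x)).
  by move/eqP; rewrite subr_eq0 => /eqP.
have sB : zmod_morphism s.
  by move=> x y; apply: Gfun (sG _) _; apply: graphB (sG x) (sG y).
have sM : monoid_morphism s.
  split=> [|x y]; first by apply: Gfun (sG _) (graph1 G).
  by apply: Gfun (sG _) _; apply: graphM (sG x) (sG y).
pose sZ := GRing.isZmodMorphism.Build F F s sB.
pose sR := GRing.isMonoidMorphism.Build F F s sM.
pose S : {rmorphism F -> F} := HB.pack s sZ sR.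
by exists S => x y Gxy; apply: Gfun (sG x) Gxy.
Qed.

Lemma algebraic_mono (F : fieldType) (K G : subiso F) : graph K `<=` graph G ->
  forall x, algebraicOver (@src F K) x -> algebraicOver (@src F G) x.
Proof.
move=> KG x [q q0 qx].
pose q' := \poly_(k < size q) mk_elt (KG _ (graph_elt q`_k)).
have q'E : map_poly (@src F G) q' = map_poly (@src F K) q.
  apply/polyP => k; rewrite !coef_map coef_poly.
  by case: ltnP => // /(nth_default 0) ->; rewrite !raddf0.
exists q'; last by rewrite q'E.
by rewrite -(map_poly_eq0 (@src F G)) q'E map_poly_eq0.
Qed.

(** Let K be a subfield maximal among those avoiding t. The other root t' of the
    minimal polynomial of t over K gives an isomorphism of K(t) onto K(t')
    sending t to t', and a maximal extension of it is defined everywhere: all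
    elements are algebraic over K, and C contains roots of all the transported
    minimal polynomials. *)
Lemma irrational_moved (C : numClosedFieldType) (t : C) :
  (forall q : rat, t <> ratr q) -> exists s : {rmorphism C -> C}, s t <> t.
Proof.
move=> t_irr; have diagZ : graph (rat_diag C) `<=` [set u | u.1 = u.2 /\ u.1 <> t].
  by move=> _ [q ->]; split=> //= /esym; apply: t_irr.
have [K [_ KZ Kmax]] := maximal_subiso diagZ.
have algK := algebraic_over_avoiding KZ Kmax.
have [p p_irr pt] := algebraic_irreducible (algK t).
have tNK a : @src C K a <> t by have [] := KZ _ (graph_elt a).
have [t' pt' t'N] := irreducible_other_root p_irr pt tNK.
have src_tgt : @src C K =1 @tgt C K by move=> a; have [] := KZ _ (graph_elt a).
have tt' q : (map_poly (@src C K) q).[t] = 0 <-> (map_poly (@tgt C K) q).[t'] = 0.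
  rewrite -(eq_map_poly src_tgt).
  exact: iff_trans (irreducible_root_dvdp p_irr pt q)
                   (iff_sym (irreducible_root_dvdp p_irr pt' q)).
have [G [HG _ Gmax]] := maximal_subiso (@subsetT _ (graph (extend tt'))).
have KG : graph K `<=` graph G by apply: subset_trans HG; apply: extend_sub.
have algG x : algebraicOver (@src C G) x by apply: algebraic_mono (algK x).
have [|s sG] := @subiso_total_morphism _ G.
  move=> x; have [r r_irr rx] := algebraic_irreducible (algG x).
  have /closed_rootP[y ry] : size (map_poly (@tgt C G) r) != 1%N.
    by rewrite size_map_poly neq_ltn r_irr.1 orbT.
  have xy q : (map_poly (@src C G) q).[x] = 0 <-> (map_poly (@tgt C G) q).[y] = 0.
    exact: iff_trans (irreducible_root_dvdp r_irr rx q)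
                     (iff_sym (irreducible_root_dvdp r_irr ry q)).
  by exists y; apply: Gmax (extend_sub xy) _ _ (extend_mem xy).
exists s; rewrite (sG t t'); first exact/eqP.
exact/HG/extend_mem.
Qed.

(** * Mirror images over the complex numbers *)

(** Two frames with the same Gram matrix differ by an orthogonal matrix O, with
    V = W O. A vector u having the same product h with all the rows of V is h / g
    times v O; comparing squares, 2h = (h / g)^2 2g, which leaves h = 0 or
    h = g. Here W is to be a real frame and V its image by f; squares of complex
    vectors carry no positivity, and invertibility of W takes its place. *)
Lemma reflected_apex (F : fieldType) n (V W : 'M[F]_n) (u v : 'rV[F]_n) (h g : F) :
  2 != 0 :> F -> g != 0 -> W \in unitmx -> V *m V^T = W *m W^T ->
  V *m u^T = const_mx h -> W *m v^T = const_mx g ->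
  u *m u^T = (h *+ 2)%:M -> v *m v^T = (g *+ 2)%:M -> u = 0 \/ h = g.
Proof.
move=> two0 g0 Wu VV Vu Wv uu vv.
have Vunit : V \in unitmx.
  have : V *m V^T \in unitmx by rewrite VV unitmx_mul unitmx_tr Wu.
  by rewrite unitmx_mul => /andP[].
pose O := invmx W *m V.
have OO : O *m O^T = 1%:M.
  rewrite trmx_mul mulmxA -(mulmxA _ V) VV mulmxA mulVmx // mul1mx.
  by rewrite -trmx_mul mulVmx // trmx1.
have VvO : V *m (v *m O)^T = const_mx g.
  have VE : V = W *m O by rewrite mulmxA mulmxV // mul1mx.
  by rewrite trmx_mul VE mulmxA -(mulmxA W) OO mulmx1.
have uE : u = (h / g) *: (v *m O).
  apply: trmx_inj; apply: (can_inj (mulKmx Vunit)).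
  rewrite Vu linearZ /= -scalemxAr VvO; apply/matrixP => i j.
  by rewrite !mxE divfK.
have /matrixP/(_ 0 0) : u *m u^T = ((h / g) ^+ 2 * (g *+ 2))%:M.
  rewrite {1 2}uE linearZ /= -scalemxAl -scalemxAr scalerA trmx_mul mulmxA.
  by rewrite -(mulmxA v) OO mulmx1 vv scale_scalar_mx expr2.
rewrite uu !mxE eqxx !mulr1n => hE.
have [h0|h0] := eqVneq h 0; [left|right].
  by rewrite uE h0 mul0r scale0r.
have : (h * 2) * (g - h) = 0.
  have hg : h *+ 2 * g = h ^+ 2 *+ 2.
    by rewrite hE expr_div_n -mulrA -mulr_natr; field.
  have -> : h * 2 * (g - h) = h *+ 2 * g - h ^+ 2 *+ 2 by ring.
  by rewrite hg subrr.
move=> /eqP; rewrite mulf_eq0 mulf_eq0 (negPf h0) (negPf two0) /= subr_eq0.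
by move/eqP.
Qed.

Lemma halfrK (F : numFieldType) (a : F) : a / 2 *+ 2 = a.
Proof. by rewrite -mulr_natr divfK // pnatr_eq0. Qed.

Lemma mulr2n_inj (F : numFieldType) : injective (fun a : F => a *+ 2).
Proof. by move=> a b /= ab; rewrite -(halfrK a) -(halfrK b) -!mulrnAl ab. Qed.

(** The formula of phi over any ring: on row vectors over R[i] the two are
    convertible, and over R it is the squared Euclidean distance. *)
Definition sqdist (F : pzRingType) n (x y : 'rV[F]_n) : F :=
  \sum_(k < n) (x 0 k - y 0 k) ^+ 2.

Lemma sqdistC (F : comPzRingType) n (x y : 'rV[F]_n) : sqdist x y = sqdist y x.
Proof. by apply: eq_bigr => k _; rewrite -sqrrN opprB. Qed.

Lemma sqdistxx (F : comPzRingType) n (x : 'rV[F]_n) : sqdist x x = 0.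
Proof. by apply: big1 => k _; rewrite subrr expr0n. Qed.

Lemma sqdistZ (F : comPzRingType) n (c : F) (x y : 'rV[F]_n) :
  sqdist (c *: x) (c *: y) = c ^+ 2 * sqdist x y.
Proof.
by rewrite /sqdist mulr_sumr; apply: eq_bigr => k _; rewrite !mxE -mulrBr exprMn.
Qed.

Lemma polarization (F : comPzRingType) n (o x y : 'rV[F]_n) :
  (\sum_k (x 0 k - o 0 k) * (y 0 k - o 0 k)) *+ 2 =
  sqdist x o + sqdist y o - sqdist x y.
Proof.
rewrite /sqdist -sumrMnl -sumrN -!big_split; apply: eq_bigr => k _ /=.
ring.
Qed.

Section Geometry.
Variables (R : realType) (n : nat).
Implicit Types (x y z : 'rV[R]_n) (f : 'rV[R]_n -> 'rV[R[i]]_n) (a b d : R).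

Lemma real_complex_sum (I : finType) (F : I -> R) :
  (\sum_i F i)%:C = \sum_i (F i)%:C :> R[i].
Proof. exact: (rmorph_sum (real_complex R)). Qed.

Lemma phiZ (c : R[i]) (u v : 'rV[R[i]]_n) : phi (c *: u) (c *: v) = c ^+ 2 * phi u v.
Proof. exact: sqdistZ. Qed.

Lemma phi_toC x y : phi (toC x) (toC y) = (sqdist x y)%:C.
Proof.
rewrite real_complex_sum /phi; apply: eq_bigr => k _.
rewrite mxE mxE.
rewrite (rmorphXn (real_complex R)) (rmorphB (real_complex R)).
reflexivity.
Qed.

Lemma enorm_sqdist x y : enorm (x - y) ^+ 2 = sqdist x y.
Proof.
rewrite sqr_sqrtr; last by apply: sumr_ge0 => k _; apply: sqr_ge0.
by apply: eq_bigr => k _; rewrite !mxE.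
Qed.

Definition keeps x y f := phi (f x) (f y) = (sqdist x y)%:C.

Lemma keepsC x y f : keeps x y f -> keeps y x f.
Proof. by rewrite /keeps -![phi _ _]/(sqdist _ _) sqdistC => ->; rewrite sqdistC. Qed.

Lemma keepsxx x f : keeps x x f.
Proof. by rewrite /keeps -![phi _ _]/(sqdist _ _) !sqdistxx. Qed.

(** If y is the mirror image of x in the hyperplane of the p i, then f y has the
    same squared distances as f x to the points f (p i). Hence f y is either the
    mirror image of f x or f x itself; the second case has to be excluded by
    other means. The frame is based at x, so that each side of the question is
    expressed by products with the vectors p i - x. *)
Lemma reflected_apex_image (p : 'I_n -> 'rV[R]_n) x y f :
  \matrix_(i, k) (p i 0 k - x 0 k) \in unitmx ->
  sqdist x y != 0 -> (forall i, sqdist (p i) y = sqdist (p i) x) ->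
  (forall i, keeps (p i) x f) -> (forall i, keeps (p i) y f) ->
  (forall i j, keeps (p i) (p j) f) ->
  keeps x y f \/ f x = f y.
Proof.
set W := \matrix_(i, k) _ => Wu xy pxy px py pp.
pose V : 'M[R[i]]_n := \matrix_(i, k) (f (p i) 0 k - f x 0 k).
pose WC := map_mx (real_complex R) W.
pose u := f y - f x; pose v := map_mx (real_complex R) (y - x).
pose h := phi (f y) (f x) / 2; pose g : R[i] := (sqdist y x)%:C / 2.
have two0 : 2 != 0 :> R[i] by rewrite pnatr_eq0.
have twoI : injective (fun a : R[i] => a *+ 2).
  exact: mulr2n_inj.
have half (a : R[i]) : a / 2 *+ 2 = a by apply: halfrK.
have polarC (A B : 'rV[R]_n) : (\sum_k (A 0 k - x 0 k)%:C * (B 0 k - x 0 k)%:C) *+ 2 =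
    (sqdist A x)%:C + (sqdist B x)%:C - (sqdist A B)%:C :> R[i].
  rewrite -(rmorphD (real_complex R)) -(rmorphB (real_complex R)) -polarization.
  rewrite (rmorphMn (real_complex R)); congr (_ *+ 2); rewrite [RHS]real_complex_sum.
  by apply: eq_bigr => k _; rewrite (rmorphM (real_complex R)).
have px' i : sqdist (f (p i)) (f x) = (sqdist (p i) x)%:C := px i.
have py' i : sqdist (f (p i)) (f y) = (sqdist (p i) y)%:C := py i.
have pp' i j : sqdist (f (p i)) (f (p j)) = (sqdist (p i) (p j))%:C := pp i j.
have [| | | | | | | |u0|hg] := @reflected_apex _ n V WC u v h g.
- exact: two0.
- by rewrite mulf_neq0 ?invr_eq0 // (fmorph_eq0 (real_complex R)) sqdistC.
- by rewrite map_unitmx.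
- apply/matrixP => i j; rewrite !mxE; apply: twoI => /=.
  transitivity (\sum_k (f (p i) 0 k - f x 0 k) * (f (p j) 0 k - f x 0 k) *+ 2).
    by rewrite sumrMnl; congr (_ *+ 2); apply: eq_bigr => k _; rewrite !mxE.
  rewrite sumrMnl polarization !px' pp'.
  rewrite -polarC; congr (_ *+ 2); apply: eq_bigr => k _.
  by rewrite !mxE.
- apply/matrixP => i j; rewrite !mxE; apply: twoI => /=.
  transitivity (\sum_k (f (p i) 0 k - f x 0 k) * (f y 0 k - f x 0 k) *+ 2).
    by rewrite sumrMnl; congr (_ *+ 2); apply: eq_bigr => k _; rewrite !mxE ?(ord1 j).
  rewrite sumrMnl polarization px' py' pxy half.
  by rewrite addrAC subrr add0r.
- apply/matrixP => i j; rewrite !mxE; apply: twoI => /=.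
  transitivity ((\sum_k (p i 0 k - x 0 k)%:C * (y 0 k - x 0 k)%:C) *+ 2 : R[i]).
    by congr (_ *+ 2); apply: eq_bigr => k _; rewrite !mxE ?(ord1 j).
  by rewrite polarC pxy half addrAC subrr add0r.
- rewrite half; apply/matrixP => i j; rewrite !ord1 !mxE mulr1n.
  by apply: eq_bigr => k _; rewrite !mxE expr2.
- rewrite half; apply/matrixP => i j; rewrite !ord1 !mxE mulr1n real_complex_sum.
  by apply: eq_bigr => k _; rewrite !mxE -expr2 (rmorphXn (real_complex R)).
- by right; apply/esym/eqP; rewrite -subr_eq0; apply/eqP.
- left; apply: keepsC; rewrite /keeps.
  have two0' : (2^-1 : R[i]) != 0 by rewrite invr_eq0.
  exact: (mulIf two0').
Qed.

End Geometry.

(** * Statements forced by finitely many unit distances *)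

(** Two pairs at equal distances are exchanged by a translation followed by the
    reflection in the hyperplane bisecting the two difference vectors. When
    these vectors agree, w = 0 and the convention 0^-1 = 0 makes the reflection
    the identity. *)
Section Isometry.
Variables (R : realType) (n : nat).
Implicit Types (u v w x y : 'rV[R]_n).

Let dot u v : R := \sum_k u 0 k * v 0 k.

Let dotBl u v w : dot (u - v) w = dot u w - dot v w.
Proof. by rewrite /dot -sumrB; apply: eq_bigr => k _; rewrite !mxE mulrBl. Qed.

Let dotC u v : dot u v = dot v u.
Proof. by apply: eq_bigr => k _; rewrite mulrC. Qed.

Let dotBr u v w : dot w (u - v) = dot w u - dot w v.
Proof. by rewrite dotC dotBl !(dotC w). Qed.

Let dotZl c u w : dot (c *: u) w = c * dot u w.
Proof. by rewrite /dot mulr_sumr; apply: eq_bigr => k _; rewrite !mxE mulrA. Qed.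

Let dotZr c u w : dot w (c *: u) = c * dot w u.
Proof. by rewrite dotC dotZl dotC. Qed.

Let sqdist_dot x y : sqdist x y = dot (x - y) (x - y).
Proof. by apply: eq_bigr => k _; rewrite !mxE expr2. Qed.

Let dot_eq0 w : dot w w = 0 -> w = 0.
Proof.
move=> /eqP; rewrite psumr_eq0 => [|k _]; last by rewrite -expr2 sqr_ge0.
move=> /allP w0; apply/rowP => k; rewrite mxE; apply/eqP.
by have := w0 k (mem_index_enum _); rewrite -expr2 sqrf_eq0.
Qed.

Let householder w u := u - (2 * dot u w / dot w w) *: w.

Let householder_sub w u v : householder w (u - v) = householder w u - householder w v.
Proof. by apply/rowP => k; rewrite !mxE dotBl; ring. Qed.

Let householder_dot w u : dot (householder w u) (householder w u) = dot u u.
Proof.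
rewrite /householder !(dotBl, dotBr, dotZl, dotZr) (dotC w u).
have [->|w0] := eqVneq (dot w w) 0; first by rewrite invr0; ring.
by field.
Qed.

Lemma isometry_between x0 y0 x y : sqdist x0 y0 = sqdist x y ->
  exists T : 'rV[R]_n -> 'rV[R]_n,
    [/\ forall u v, sqdist (T u) (T v) = sqdist u v, T x0 = x & T y0 = y].
Proof.
move=> xy0; pose w := (y0 - x0) - (y - x).
exists (fun z => x + householder w (z - x0)); split=> [u v||].
- rewrite !sqdist_dot -(householder_dot w (u - v)) opprD addrACA subrr add0r.
  by rewrite -householder_sub opprB addrA subrK.
- rewrite subrr /householder; apply/rowP => k; rewrite !mxE.
  have -> : dot 0 w = 0 by apply: big1 => j _; rewrite mxE mul0r.
  by ring.
- suff -> : householder w (y0 - x0) = y - x by rewrite addrC subrK.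
  rewrite sqdistC (sqdistC x) !sqdist_dot in xy0.
  have [/dot_eq0 w0|w0] := eqVneq (dot w w) 0.
    have : w = 0 by []; rewrite {1}/w => /eqP; rewrite subr_eq0 => /eqP <-.
    by rewrite /householder w0 scaler0 subr0.
  have ww : dot w w = 2 * dot (y0 - x0) w.
    rewrite /w; move: (y0 - x0) (y - x) xy0 => A B AB.
    by rewrite !(dotBl, dotBr) AB (dotC B A); ring.
  by rewrite /householder -ww divff // scale1r /w opprB addrC subrK.
Qed.

End Isometry.

Section Forced.
Variables (R : realType) (n : nat).
Implicit Types (x y z : 'rV[R]_n) (f : 'rV[R]_n -> 'rV[R[i]]_n) (a b d : R).
Implicit Types P Q : ('rV[R]_n -> 'rV[R[i]]_n) -> Prop.

(** The properties of f that follow from its preserving the unit distances of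
    some finite set form a filter. Membership in D_n becomes the statement that
    keeps x y is in this filter, and deductions from finitely many members
    replace the bookkeeping of finite sets. *)
Definition forced P := exists2 S : set 'rV[R]_n, finite_set S &
  forall f, preserves_unit_dist S f -> P f.

Lemma unit_dist_sub (S S' : set 'rV[R]_n) f : S `<=` S' ->
  preserves_unit_dist S' f -> preserves_unit_dist S f.
Proof. by move=> SS' fS' x y Sx Sy; apply: fS'; apply: SS'. Qed.

Lemma forced_mono P Q : (forall f, P f -> Q f) -> forced P -> forced Q.
Proof. by move=> PQ [S Sfin SP]; exists S => // f /SP/PQ. Qed.

Lemma forced_forall (I : choiceType) (A : set I) (P : I -> _ -> Prop) :
  finite_set A -> (forall i, A i -> forced (P i)) ->
  forced (fun f => forall i, A i -> P i f).
Proof.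
move=> Afin AP.
have /choice[S SP] : forall i, exists S : set 'rV[R]_n, A i ->
    finite_set S /\ forall f, preserves_unit_dist S f -> P i f.
  by move=> i; have [/AP[S ? ?]|nA] := pselect (A i); [exists S|exists set0].
exists (\bigcup_(i in A) S i); first by apply: bigcup_finite => // i /SP[].
move=> f fS i Ai; apply: (SP i Ai).2; apply: unit_dist_sub fS.
by move=> x Sx; exists i.
Qed.

Lemma forced_ord m (P : 'I_m -> _ -> Prop) :
  (forall i, forced (P i)) -> forced (fun f => forall i, P i f).
Proof.
move=> fP; have := @forced_forall _ setT P finite_finset (fun i _ => fP i).
by apply: forced_mono => f fPi i; apply: fPi.
Qed.

Lemma forced_and P Q : forced P -> forced Q -> forced (fun f => P f /\ Q f).
Proof.
move=> [S Sfin SP] [S' S'fin SQ]; exists (S `|` S').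
  by rewrite finite_setU.
move=> f fS; split; [apply: SP|apply: SQ]; apply: unit_dist_sub fS => x Sx.
  by left.
by right.
Qed.

Lemma forced_true P : (forall f, P f) -> forced P.
Proof. by move=> P_; exists set0. Qed.

Lemma D_setP d : D_set R n d <->
  0 < d /\ forall x y, sqdist x y = d ^+ 2 -> forced (keeps x y).
Proof.
split=> [[d0 dD]|[d0 dD]]; split=> // x y xy.
  have [|S [Sfin _ Sxy]] := dD x y.
    apply/eqP; rewrite -(@eqrXn2 _ 2) ?sqrtr_ge0 ?(ltW d0) //.
    by rewrite enorm_sqdist xy.
  by exists S => // f /Sxy; rewrite /preserves_dist_between enorm_sqdist.
have [|S Sfin SP] := dD x y; first by rewrite -enorm_sqdist xy.
exists (S `|` [set x; y]); split.
- by rewrite finite_setU; split=> //; rewrite finite_setU; split; exact: finite_set1.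
- by move=> z; right.
- move=> f fS; rewrite /preserves_dist_between enorm_sqdist; apply: SP.
  by apply: unit_dist_sub fS => z; left.
Qed.

Lemma D_set1 : D_set R n 1.
Proof.
apply/D_setP; split=> // x y xy; exists [set x; y].
  by rewrite finite_setU; split; exact: finite_set1.
move=> f /(_ x y); rewrite /keeps phi_toC xy; apply=> //; [by left|by right].
Qed.

(** Let T multiply distances by d, and let S be the finite set forcing P. The
    images by T of the unit distances of S equal d, hence are forced to be
    preserved, finitely many at a time; rescaled by 1 / d, the map f o T then
    preserves the unit distances of S. *)
Lemma forced_similar d (T : 'rV[R]_n -> 'rV[R]_n) P : D_set R n d ->
  (forall u v, sqdist (T u) (T v) = d ^+ 2 * sqdist u v) ->
  forced P -> forced (fun f => P (fun z => d^-1%:C *: f (T z))).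
Proof.
move=> /D_setP[d0 dD] Td [S Sfin SP].
pose good (uv : 'rV[R]_n * 'rV[R]_n) f := sqdist uv.1 uv.2 = 1 ->
  keeps (T uv.1) (T uv.2) f.
have : forced (fun f => forall uv, (S `*` S) uv -> good uv f).
  apply: forced_forall => [|uv _]; first exact: finite_setX.
  have [uv1|uvN1] := eqVneq (sqdist uv.1 uv.2) 1.
    have Tuv : forced (keeps (T uv.1) (T uv.2)) by apply: dD; rewrite Td uv1 mulr1.
    by apply: forced_mono Tuv => f fP _.
  by apply: forced_true => f uv1; rewrite uv1 eqxx in uvN1.
apply: forced_mono => f fT; apply: SP => u v Su Sv.
rewrite phi_toC expr1n => /complexI uv1; have := fT (u, v) (conj Su Sv) uv1.
rewrite /keeps Td uv1 mulr1 /= => fuv.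
rewrite phiZ fuv -(rmorphXn (real_complex R)) -(rmorphM (real_complex R)).
by rewrite exprVn mulVf // sqrf_eq0 gt_eqF.
Qed.

End Forced.

(** * Reflections and triangles *)

Section Distances.
Variables (R : realType) (n : nat).
Implicit Types (x y z : 'rV[R]_n) (f : 'rV[R]_n -> 'rV[R[i]]_n) (a b d : R).

(** A configuration witnessing b, enlarged by the factor a, uses only distances
    equal to a. *)
Lemma D_setM a b : D_set R n a -> D_set R n b -> D_set R n (a * b).
Proof.
move=> aD bD; have /D_setP[a0 _] := aD; have /D_setP[b0 bP] := bD.
apply/D_setP; split=> [|x y xy]; first exact: mulr_gt0.
have aN0 : a != 0 by rewrite gt_eqF.
have xy' : sqdist (a^-1 *: x) (a^-1 *: y) = b ^+ 2.
  by rewrite sqdistZ xy exprMn exprVn mulKf // sqrf_eq0.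
have := forced_similar aD (@sqdistZ R n a) (bP _ _ xy').
apply: forced_mono => f; rewrite /keeps !scalerA divff // !scale1r phiZ xy' xy.
have aC : (a^-1)%:C != 0 :> R[i] by rewrite (fmorph_eq0 (real_complex R)) invr_eq0.
move=> fxy; have aC2 : (a^-1)%:C ^+ 2 != 0 :> R[i] by rewrite sqrf_eq0.
apply: (mulfI aC2); rewrite fxy -(rmorphXn (real_complex R)).
rewrite -(rmorphM (real_complex R)); congr (real_complex _).
by rewrite exprMn exprVn mulKf // sqrf_eq0.
Qed.

Lemma D_setX a k : D_set R n a -> D_set R n (a ^+ k).
Proof.
move=> aD; elim: k => [|k IHk]; first exact: D_set1.
by rewrite exprS; apply: D_setM.
Qed.

(** Transport by an isometry, the case d = 1 of forced_similar. *)
Lemma forced_congruent (P : 'rV[R[i]]_n -> 'rV[R[i]]_n -> Prop) x0 y0 x y :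
  sqdist x0 y0 = sqdist x y ->
  forced (fun f : 'rV[R]_n -> _ => P (f x0) (f y0)) ->
  forced (fun f : 'rV[R]_n -> _ => P (f x) (f y)).
Proof.
move=> /isometry_between[T [Tiso <- <-]] P0.
have T1 u v : sqdist (T u) (T v) = 1 ^+ 2 * sqdist u v by rewrite expr1n mul1r.
have := forced_similar (D_set1 R n) T1 P0; apply: forced_mono => f.
by rewrite invr1 !scale1r.
Qed.

Definition keeps_or_merges x y f := keeps x y f \/ f x = f y.

(** What a mirror configuration yields on its own: the endpoints of a segment
    of length d may still be merged by f. *)
Definition weak_set : set R := [set d | 0 < d /\
  forall x y, sqdist x y = d ^+ 2 -> forced (keeps_or_merges x y)].

Lemma D_weak d : D_set R n d -> weak_set d.
Proof.
move=> /D_setP[d0 dP]; split=> // x y /dP.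
by apply: forced_mono => f; left.
Qed.

Lemma D_set_pair d x y : 0 < d -> sqdist x y = d ^+ 2 -> forced (keeps x y) ->
  D_set R n d.
Proof.
move=> d0 xy fxy; apply/D_setP; split=> // x' y' xy'.
pose P (u v : 'rV[R[i]]_n) := phi u v = (d ^+ 2)%:C.
have := @forced_congruent P x y x' y'; rewrite xy xy' => /(_ erefl).
rewrite /P /keeps xy'; apply; move: fxy.
by apply: forced_mono => f; rewrite /keeps xy.
Qed.

Lemma weak_pair d x y : 0 < d -> sqdist x y = d ^+ 2 -> forced (keeps_or_merges x y) ->
  weak_set d.
Proof.
move=> d0 xy fxy; split=> // x' y' xy'.
pose P (u v : 'rV[R[i]]_n) := phi u v = (d ^+ 2)%:C \/ u = v.
have := @forced_congruent P x y x' y'; rewrite xy xy' => /(_ erefl).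
rewrite /P /keeps_or_merges /keeps xy'; apply; move: fxy.
by apply: forced_mono => f; rewrite /keeps_or_merges /keeps xy.
Qed.

Lemma keeps_dist d x y : D_set R n d -> sqdist x y = d ^+ 2 -> forced (keeps x y).
Proof. by move=> /D_setP[_]; apply. Qed.

(** The mirror configuration, once all of its edges other than xy have lengths
    in D_n. *)
Lemma weak_reflection (p : 'I_n -> 'rV[R]_n) x y d :
  0 < d -> sqdist x y = d ^+ 2 ->
  \matrix_(i, k) (p i 0 k - x 0 k) \in unitmx ->
  (forall i, sqdist (p i) y = sqdist (p i) x) ->
  (forall i, exists2 a, D_set R n a & sqdist (p i) x = a ^+ 2) ->
  (forall i j, i != j -> exists2 a, D_set R n a & sqdist (p i) (p j) = a ^+ 2) ->
  weak_set d.
Proof.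
move=> d0 xy pu pyx px pp; apply: (weak_pair d0 xy).
have Fx : forced (fun f => forall i, keeps (p i) x f).
  by apply: forced_ord => i; have [a aD pix] := px i; apply: keeps_dist aD pix.
have Fy : forced (fun f => forall i, keeps (p i) y f).
  by apply: forced_ord => i; have [a aD pix] := px i; apply: keeps_dist aD _; rewrite pyx.
have Fp : forced (fun f => forall i j, keeps (p i) (p j) f).
  apply: forced_ord => i; apply: forced_ord => j.
  have [->|ij] := eqVneq i j; first exact/forced_true/keepsxx.
  by have [a aD pij] := pp i j ij; apply: keeps_dist aD pij.
have := forced_and Fx (forced_and Fy Fp); apply: forced_mono => f [fx [fy fp]].
by apply: (reflected_apex_image (p := p)) => //; rewrite xy sqrf_eq0 gt_eqF.
Qed.

End Distances.

Section Plane.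
Variables (R : realType) (m : nat).
Local Notation n := m.+2.

Definition planar (a b : R) : 'rV[R]_n :=
  \row_(k < n) (if k == 0 then a else if k == 1 then b else 0).

Lemma sqdist_planar a b a' b' :
  sqdist (planar a b) (planar a' b') = (a - a') ^+ 2 + (b - b') ^+ 2.
Proof.
rewrite /sqdist big_ord_recl big_ord_recl !mxE /= big1 ?addr0 // => k _.
by rewrite !mxE /= subrr expr0n.
Qed.

(** In a triangle xyz with sides d = xy, a = xz, b = yz, merging x and y would
    give xz and yz the same image, of square b^2, whereas the image of xz has
    square a^2 or 0. The two inequalities are those for the triangle to exist. *)
Lemma exclude_merging (d a b : R) : weak_set n d -> weak_set n a -> D_set R n b ->
  b != a -> (d - a) ^+ 2 <= b ^+ 2 <= (d + a) ^+ 2 -> D_set R n d.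
Proof.
move=> [d0 dP] [a0 aP] bD ba /andP[b1 b2].
pose u := (d ^+ 2 + a ^+ 2 - b ^+ 2) / (2 * d).
have u2 : 2 * d * u = d ^+ 2 + a ^+ 2 - b ^+ 2.
  by rewrite /u mulrC divfK // mulf_neq0 ?pnatr_eq0 // gt_eqF.
have ua : u ^+ 2 <= a ^+ 2.
  have : 0 <= (2 * d) ^+ 2 * (a ^+ 2 - u ^+ 2).
    have -> : (2 * d) ^+ 2 * (a ^+ 2 - u ^+ 2) =
      (2 * d * a - 2 * d * u) * (2 * d * a + 2 * d * u) by ring.
    by rewrite u2 mulr_ge0 //; nra.
  by rewrite pmulr_rge0 ?subr_ge0 // exprn_gt0 // mulr_gt0.
pose v := Num.sqrt (a ^+ 2 - u ^+ 2).
have v2 : v ^+ 2 = a ^+ 2 - u ^+ 2 by rewrite sqr_sqrtr // subr_ge0.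
pose x := planar 0 0; pose y := planar d 0; pose z := planar u v.
have xy : sqdist x y = d ^+ 2 by rewrite sqdist_planar; ring.
have xz : sqdist x z = a ^+ 2 by rewrite sqdist_planar !sub0r !sqrrN v2; ring.
have yz : sqdist y z = b ^+ 2.
  rewrite sqdist_planar sub0r sqrrN v2.
  have -> : (d - u) ^+ 2 + (a ^+ 2 - u ^+ 2) = d ^+ 2 + a ^+ 2 - 2 * d * u by ring.
  by rewrite u2; ring.
apply: (D_set_pair d0 xy).
have := forced_and (dP x y xy) (forced_and (aP x z xz) (keeps_dist bD yz)).
apply: forced_mono => f [[//|fxy] [fxz fyz]].
have b0 : 0 < b by have /D_setP[] := bD.
case: fxz => [fxz|fxz]; move: fyz.
  rewrite /keeps in fxz *; rewrite -fxy fxz xz yz => /complexI/eqP.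
  by rewrite eqrXn2 ?ltW // eq_sym (negPf ba).
rewrite /keeps -fxy fxz; have := keepsxx z f; rewrite /keeps => -> /complexI/eqP.
by rewrite yz sqdistxx eq_sym sqrf_eq0 gt_eqF.
Qed.

(** The isosceles triangle with sides d, d, 1. *)
Lemma exclude_merging1 (d : R) : weak_set n d -> d != 1 -> 1 <= 4 * d ^+ 2 ->
  D_set R n d.
Proof.
move=> dW d1 d4; apply: (exclude_merging dW dW (D_set1 R n)); first by rewrite eq_sym.
have -> : (d + d) ^+ 2 = 4 * d ^+ 2 by ring.
by rewrite subrr expr0n expr1n ler01.
Qed.

(** The base is a regular simplex with n vertices and edge e, the points p i are
    its vertices and x, y are the two points at distance a from all of them.
    Taking the multiples s e_i of the standard basis as base puts x and y on the
    diagonal, and the squared distance xy is 4 (a^2 - rho^2), where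
    rho^2 = (1 - 1/n) e^2 / 2 is the squared circumradius of the base. *)
Lemma isosceles (a e d : R) : D_set R n a -> D_set R n e -> 0 < d ->
  d ^+ 2 = 4 * a ^+ 2 - (2 - 2 / n%:R) * e ^+ 2 -> weak_set n d.
Proof.
move=> aD eD d0 dE; have [N N_n] : exists N : R, N = n%:R by exists n%:R.
have N0 : 0 < N by rewrite N_n ltr0n.
have NE : N = m.+1%:R + 1 by rewrite N_n -natr1.
pose s := e / Num.sqrt 2; pose q := d / Num.sqrt N.
have s2 : 2 * s ^+ 2 = e ^+ 2.
  by rewrite expr_div_n sqr_sqrtr // mulrC divfK // pnatr_eq0.
have q2 : N * q ^+ 2 = d ^+ 2.
  by rewrite expr_div_n sqr_sqrtr ?ltW // mulrC divfK // gt_eqF.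
pose p (i : 'I_n) : 'rV[R]_n := s *: delta_mx 0 i.
have dist_const i t : sqdist (p i) (const_mx t) = (s - t) ^+ 2 + m.+1%:R * t ^+ 2.
  rewrite /sqdist (bigD1 i) //= !mxE !eqxx mulr1; congr (_ + _).
  rewrite (eq_bigr (fun=> t ^+ 2)) => [|k ki].
    by rewrite sumr_const cardC1 card_ord mulr_natl.
  by rewrite !mxE (negPf ki) andbF mulr0 sub0r sqrrN.
have dist_apex i (t : R) : t ^+ 2 = (q / 2) ^+ 2 ->
    sqdist (p i) (const_mx (s / N + t)) = a ^+ 2.
  move=> t2; rewrite dist_const.
  have -> : m.+1%:R = N - 1 :> R by rewrite NE addrK.
  have -> : (s - (s / N + t)) ^+ 2 + (N - 1) * (s / N + t) ^+ 2 =
     (2 * s ^+ 2) * (1 - N^-1) / 2 + N * t ^+ 2 by field; rewrite gt_eqF.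
  rewrite t2 s2; have -> : N * (q / 2) ^+ 2 = d ^+ 2 / 4 by rewrite -q2; field.
  by rewrite dE -N_n; field; rewrite gt_eqF.
apply: (@weak_reflection _ _ p (const_mx (s / N + q / 2)) (const_mx (s / N - q / 2)) d).
- exact: d0.
- rewrite /sqdist (eq_bigr (fun=> q ^+ 2)) => [|k _].
    by rewrite sumr_const card_ord -q2 N_n mulr_natl.
  by rewrite !mxE; congr (_ ^+ 2); field; rewrite gt_eqF.
- set t := s / N + q / 2; pose J : 'M[R]_n := const_mx 1.
  have e0 : 0 < e by have /D_setP[] := eD.
  have s0 : s != 0 by rewrite gt_eqF // divr_gt0 // sqrtr_gt0 ltr0n.
  have JJ : J *m J = N *: J.
    apply/matrixP => i j; rewrite !mxE (eq_bigr (fun=> 1)) => [|k _].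
      by rewrite sumr_const card_ord mulr1 N_n.
    by rewrite !mxE mulr1.
  have -> : \matrix_(i, k) (p i 0 k - (const_mx t : 'rV[R]_n) 0 k) = s%:M - t *: J.
    apply/matrixP => i k; rewrite !mxE eqxx /= mulr1 eq_sym.
    by case: eqP; rewrite ?mulr1n ?mulr0n ?mulr1 ?mulr0.
  (* an inverse of s - t J, where J is the all-one matrix and J J = N J *)
  pose c := t / (s - N * t).
  have tN : s - N * t != 0.
    have -> : s - N * t = - (N * q) / 2 by rewrite /t; field; rewrite gt_eqF.
    rewrite mulf_neq0 ?invr_eq0 ?pnatr_eq0 // oppr_eq0 mulf_neq0 ?gt_eqF //.
    by rewrite divr_gt0 // sqrtr_gt0.
  suff /mulmx1_unit[] : (s%:M - t *: J) *m (s^-1 *: (1%:M + c *: J)) = 1%:M by [].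
  rewrite -scalemxAr mulmxDr mulmx1 mulmxBl mul_scalar_mx -scalemxAl -scalemxAr JJ.
  apply/matrixP => i j; rewrite !mxE; case: (i == j); rewrite /= ?mulr1n ?mulr0n;
    by rewrite /c; field; rewrite s0 tN.
- by move=> i; rewrite !dist_apex // sqrrN.
- by move=> i; exists a => //; apply: dist_apex.
- move=> i j ij; exists e => //.
  rewrite /sqdist (bigD1 i) //= (bigD1 j) 1?eq_sym //= !mxE !eqxx (negPf ij).
  rewrite eq_sym (negPf ij) /=.
  rewrite big1 => [|k /andP[ki kj]]; first by rewrite -s2; ring.
  by rewrite !mxE (negPf ki) (negPf kj) !andbF !mulr0 subrr expr0n.
Qed.

End Plane.

(** * Multiplicative semigroups of positive reals *)

Section Density.
Variable R : realType.

(** Bernoulli's inequality. *)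
Lemma large_power (s M : R) : 1 < s -> exists k, M < s ^+ k.+1.
Proof.
move=> s1; have s10 : 0 < s - 1 by rewrite subr_gt0.
have bernoulli k : 1 + (s - 1) * k%:R <= s ^+ k.
  elim: k => [|k IHk]; first by rewrite mulr0 addr0 expr0.
  have sk : 1 <= s ^+ k by rewrite exprn_ege1 // ltW.
  by rewrite -natr1 exprSr; nra.
exists (Num.bound (`|M| / (s - 1))).
have := archi_boundP (divr_ge0 (normr_ge0 M) (ltW s10)); set k := Num.bound _.
rewrite ltr_pdivrMr // => Mk; have := bernoulli k.+1; have := ler_norm M.
by rewrite -natr1; nra.
Qed.

Lemma small_power (t m : R) : 0 < t -> t < 1 -> 0 < m -> exists k, t ^+ k.+1 < m.
Proof.
move=> t0 t1 m0; have [|k mk] := @large_power t^-1 m^-1; first by rewrite invf_gt1.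
by exists k; rewrite -ltf_pV2 ?posrE ?exprn_gt0 // -exprVn.
Qed.

(** The first term reaching r overshoots it by a factor less than s. *)
Lemma geometric_hits (a r s : R) : 0 < a -> a < r -> 1 < s ->
  exists k, r <= a * s ^+ k.+1 < r * s.
Proof.
move=> a0 ar s1; have s0 : 0 < s := lt_trans ltr01 s1.
have exk : exists k, r <= a * s ^+ k.
  have [k rk] := large_power (r / a) s1; exists k.+1.
  by rewrite mulrC -ler_pdivrMr // ltW.
case: (ex_minnP exk) => -[|k] rk kmin.
  by move: rk; rewrite expr0 mulr1 leNgt ar.
exists k; rewrite rk /= exprSr mulrA ltr_pM2r // ltNge.
by apply/negP => /kmin; rewrite ltnn.
Qed.

(** Otherwise al, the infimum of the elements above 1, and be, the supremum of
    those below 1, satisfy be < 1 < al. The product of an element close to al by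
    one close to be lies strictly between be and al and is not 1, so it is an
    element on one side of 1 that is closer to 1 than al or be. *)
Lemma semigroup_near1 (S : set R) (u w : R) :
  (forall a b, S a -> S b -> S (a * b)) -> ~ S 1 ->
  S u -> 1 < u -> S w -> 0 < w -> w < 1 ->
  (forall h, 1 < h -> exists2 s, S s & 1 < s < h) \/
  (forall h, h < 1 -> exists2 s, S s & h < s < 1).
Proof.
move=> SM S1 Su u1 Sw w0 w1; apply: contrapT => /not_orP[].
move=> /existsNP[h /not_implyP[h1 /forall2NP noh]].
move=> /existsNP[l /not_implyP[l1 /forall2NP nol]].
pose above := [set s | S s /\ 1 < s]; pose below := [set s | S s /\ s < 1].
have above_inf : has_inf above.
  by split; [exists u | exists 1 => s [_ /ltW]].
have below_sup : has_sup below.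
  by split; [exists w | exists 1 => s [_ /ltW]].
pose al := inf above; pose be := sup below.
have al_le s : S s -> 1 < s -> al <= s.
  by move=> Ss s1; apply: ge_inf => //; exact: above_inf.2.
have be_ge s : S s -> s < 1 -> s <= be.
  by move=> Ss s1; apply: ub_le_sup => //; exact: below_sup.2.
have al1 : 1 < al.
  apply: lt_le_trans h1 _; apply: lb_le_inf; first exact: above_inf.1.
  by move=> s [Ss s1]; have [//|/negP] := noh s; rewrite s1 /= -leNgt.
have be1 : be < 1.
  apply: le_lt_trans l1; apply: ge_sup; first exact: below_sup.1.
  by move=> s [Ss s1]; have [//|/negP] := nol s; rewrite s1 andbT -leNgt.
have be0 : 0 < be by apply: lt_le_trans w0 _; apply: be_ge.
have al0 : 0 < al := lt_trans ltr01 al1.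
have alal : al < al / be by rewrite ltr_pdivlMr // gtr_pMr.
have bebe : be / al < be by rewrite ltr_pdivrMr // ltr_pMr.
have [s [Ss s1] sal] := inf_lt above_inf.1 alal.
have [t [St t1] tbe] := sup_gt below_sup.1 bebe.
have st_lt : s * t < al.
  have sbe : s * be < al by rewrite -ltr_pdivlMr.
  apply: le_lt_trans sbe; rewrite ler_pM2l ?be_ge //; exact: lt_trans s1.
have st_gt : be < s * t.
  have tal : be < t * al by rewrite -ltr_pdivrMr.
  apply: lt_le_trans tal _; rewrite mulrC ler_pM2r ?al_le //.
  by apply: lt_trans tbe; rewrite divr_gt0.
have [st1|st1|st1] := ltgtP (s * t) 1.
- by have := be_ge _ (SM _ _ Ss St) st1; rewrite leNgt st_gt.
- by have := al_le _ (SM _ _ Ss St) st1; rewrite leNgt st_lt.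
- by apply: S1; rewrite -st1; apply: SM.
Qed.

(** Powers of an element close to 1 form a fine geometric progression; it is
    started from a small power of w when that element exceeds 1, from a large
    power of u otherwise. *)
Lemma dense_semigroup (S : set R) (u w : R) :
  (forall a b, S a -> S b -> S (a * b)) -> ~ S 1 ->
  S u -> 1 < u -> S w -> 0 < w -> w < 1 ->
  forall r e, 0 < r -> 0 < e -> exists2 s, S s & `|r - s| < e.
Proof.
move=> SM S1 Su u1 Sw w0 w1 r e r0 e0.
have SX a k : S a -> S (a ^+ k.+1).
  by move=> Sa; elim: k => [|k IHk]; rewrite ?expr1 // exprS; apply: SM.
have er0 : 0 < e / r by rewrite divr_gt0.
have re : r * (e / r) = e by rewrite mulrC divfK // gt_eqF.
have [near1|near1] := semigroup_near1 SM S1 Su u1 Sw w0 w1.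
  have [|s Ss /andP[s1 se]] := near1 (1 + e / r); first by rewrite ltrDl.
  have [k wr] := small_power w0 w1 r0.
  have [j /andP[j1 j2]] := geometric_hits (exprn_gt0 k.+1 w0) wr s1.
  exists (w ^+ k.+1 * s ^+ j.+1); first by apply: SM; apply: SX.
  rewrite distrC ger0_norm ?subr_ge0 // ltrBlDl; apply: lt_trans j2 _.
  by rewrite -{2}(mulr1 r) -re -mulrDr ltr_pM2l.
(* the bound 1/2 keeps t positive even when e exceeds r *)
have [|t St /andP[te t1]] := near1 (Num.max (2^-1) (1 - e / r)).
  by rewrite gt_max invf_lt1 ?ltr1n // gtrDl oppr_lt0.
have t0 : 0 < t by apply: lt_trans te; rewrite lt_max invr_gt0 ltr0n.
have {}te : 1 - e / r < t by apply: le_lt_trans te; rewrite le_max lexx orbT.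
have u0 : 0 < u := lt_trans ltr01 u1.
have [k ur] := large_power r u1.
have [|||j] := @geometric_hits (u ^+ k.+1)^-1 r^-1 t^-1.
- by rewrite invr_gt0 exprn_gt0.
- by rewrite ltf_pV2 ?posrE ?exprn_gt0.
- by rewrite invf_gt1.
rewrite exprVn -!invfM lef_pV2 ?ltf_pV2 ?posrE ?mulr_gt0 ?exprn_gt0 // => /andP[j1 j2].
exists (u ^+ k.+1 * t ^+ j.+1); first by apply: SM; apply: SX.
rewrite ger0_norm ?subr_ge0 // ltrBlDr -ltrBlDl; apply: le_lt_trans j2.
by rewrite -{1}(mulr1 r) -re -mulrBr ler_pM2l // ltW.
Qed.

End Density.

(** * Two independent elements of the set of forced distances *)

Section SpecialDistances.
Variable R : realType.

Lemma square_root (a : R) : 0 < a -> exists2 b : R, 0 < b & b ^+ 2 = a.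
Proof. by move=> a0; exists (Num.sqrt a); rewrite ?sqrtr_gt0 ?sqr_sqrtr // ltW. Qed.

Lemma neq1_sqr (a : R) : a ^+ 2 != 1 -> a != 1.
Proof. by apply: contra_neq => ->; rewrite expr1n. Qed.

(** Two regular unit simplices glued along a facet. *)
Lemma D_set_simplices m :
  exists2 c : R, D_set R m.+2 c & c ^+ 2 = 2 + 2 / m.+2%:R.
Proof.
have [v vE] : exists v : R, v = 2 / m.+2%:R by exists (2 / m.+2%:R).
have v0 : 0 < v by rewrite vE divr_gt0 // ltr0n.
rewrite -vE; have [|c c0 c2] := @square_root (2 + v); first by lra.
exists c => //; apply: exclude_merging1.
- apply: (isosceles (D_set1 R m.+2) (D_set1 R m.+2) c0).
  by rewrite -vE c2 expr1n; ring.
- by apply: neq1_sqr; rewrite c2 gt_eqF //; lra.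
- by rewrite c2; lra.
Qed.

(** From a and e with integral squares, 4 a^2 - e^2 is again an integer, never
    in the interval between 0 and 1. The reflection of the triangle with sides 1,
    sqrt 3, sqrt 3 in one of its long sides gives 11/3, and the isosceles
    triangle with legs 1 over a base of square 11/3 then gives
    4 - 11/3 = 1/3. *)
Lemma D_set_plane : exists u w : R,
  [/\ D_set R 2 u, D_set R 2 w, 0 < u, 0 < w & u ^+ 2 = 11 / 3 /\ w ^+ 2 = 1 / 3].
Proof.
have [c cD c2] := D_set_simplices 0; have {}c2 : c ^+ 2 = 3 by rewrite c2; field.
have c0 : 0 < c by have /D_setP[] := cD.
have [|u u0 u2] := @square_root (11 / 3); first by lra.
have [|h h0 h2] := @square_root (11 / 12); first by lra.
have [|w w0 w2] := @square_root (1 / 3); first by lra.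
exists u, w; suff uD : D_set R 2 u.
  split=> //; apply: exclude_merging1.
  - by apply: (isosceles (D_set1 R 2) uD w0); rewrite expr1n u2 w2; field.
  - by apply: neq1_sqr; rewrite w2 lt_eqF //; lra.
  - by rewrite w2; lra.
apply: exclude_merging1; last 2 first.
- by apply: neq1_sqr; rewrite u2 gt_eqF //; lra.
- by rewrite u2; lra.
pose p (i : 'I_2) : 'rV[R]_2 := planar 0 (if i == 0 then c else 0) 0.
pose b := 5 * c / 6.
have b2 : b ^+ 2 = 25 / 12.
  have -> : b ^+ 2 = 25 / 36 * c ^+ 2 by rewrite /b; field.
  by rewrite c2; field.
have cb : (c - b) ^+ 2 = 1 / 12.
  have -> : (c - b) ^+ 2 = 1 / 36 * c ^+ 2 by rewrite /b; field.
  by rewrite c2; field.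
apply: (@weak_reflection _ _ p (planar 0 b h) (planar 0 b (- h))) => //.
- rewrite sqdist_planar u2; have -> : (b - b) ^+ 2 + (h - - h) ^+ 2 = 4 * h ^+ 2 by ring.
  by rewrite h2; field.
- rewrite unitmxE (expand_det_row _ ord0) !big_ord_recl big_ord0 /cofactor.
  rewrite !det_mx11 !mxE /= unitfE.
  rewrite (_ : (0 + bump 0 0)%N = 1%N) // addn0 expr0 expr1.
  rewrite (_ : _ + _ = - (c * h)); last by ring.
  by rewrite oppr_eq0 mulf_neq0 ?gt_eqF.
- by move=> i; rewrite !sqdist_planar; ring.
- move=> i; rewrite /p sqdist_planar; case: (i == 0).
    by exists 1; [exact: D_set1|rewrite cb sub0r sqrrN h2; field].
  by exists c => //; rewrite !sub0r !sqrrN b2 h2 c2; field.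
- move=> i j ij; exists c => //; rewrite /p sqdist_planar subrr expr0n addr0.
  by case: i j ij => [[|[|//]] ?] [[|[|//]] ?] //= _; rewrite ?subr0 ?sub0r ?sqrrN.
Qed.

(** Legs 1 and base edges c give the square 4/n^2. For n at most 4 the triangle
    with sides 2/n, 2/n, 1 excludes merging. For larger n that triangle does not
    exist, and it is the multiple (2/n) c^2 that is shown to be in D_n, by a
    triangle with sides c^2 = 2 + 2/n and 2 + 6/n; this last number arises from
    legs c^2 over edges g, where g^2 = 6 + 10/n arises from legs c over edges
    1. *)
Lemma D_set_space m (n := m.+3) :
  exists2 c2 : R, D_set R n c2 & c2 = 2 + 2 / n%:R /\
    exists2 k : nat, D_set R n (2 / n%:R * c2 ^+ k) & 2 / n%:R * c2 ^+ k < 1.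
Proof.
have [c cD c2] := D_set_simplices m.+1; rewrite -/n in cD c2.
exists (c ^+ 2); first exact: D_setX.
split=> //; have c2D := D_setX 2 cD; have c3D := D_setX 3 cD.
have c0 : 0 < c by have /D_setP[] := cD.
have c6 : (c ^+ 3) ^+ 2 = (c ^+ 2) ^+ 3 by rewrite -!exprM.
have [v vE] : exists v : R, v = n%:R^-1 by exists n%:R^-1.
have nv : n%:R * v = 1 by rewrite vE mulfV // pnatr_eq0.
have v0 : 0 < v by rewrite vE invr_gt0 ltr0n.
rewrite -vE in c2 *.
have iso := @isosceles R m.+1; rewrite -/n -vE in iso.
have [n4|n5] := leqP n 4.
  exists 0%N; rewrite expr0 mulr1; last first.
    have : 3 <= n%:R :> R by rewrite ler_nat.
    nra.
  have n4R : n%:R <= 4 :> R by rewrite ler_nat.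
  have n3R : 3 <= n%:R :> R by rewrite ler_nat.
  apply: exclude_merging1.
  - apply: (iso _ _ _ (D_set1 R n) cD); first lra.
    by rewrite c2 expr1n; ring.
  - by rewrite lt_eqF //; nra.
  - nra.
have n5R : 5 <= n%:R :> R by rewrite ler_nat.
have v5 : v <= 1 / 5 by nra.
exists 1%N; rewrite expr1 c2; last by nra.
have [|g g0 g2] := @square_root (6 + 10 * v); first lra.
have gD : D_set R n g.
  apply: exclude_merging1.
  - by apply: (iso _ _ _ cD (D_set1 R n) g0); rewrite c2 g2 expr1n; ring.
  - by apply: neq1_sqr; rewrite g2 gt_eqF //; lra.
  - by rewrite g2; lra.
have bD : D_set R n (2 + 6 * v).
  apply: exclude_merging1.
  - apply: (iso _ _ _ c2D gD); first lra.
    by rewrite c2 g2; ring.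
  - by rewrite gt_eqF //; lra.
  - nra.
apply: (exclude_merging _ (D_weak c2D) bD).
- apply: (iso _ _ _ c2D c3D); first by rewrite !mulr_gt0 //; lra.
  by rewrite c6 c2; ring.
- by rewrite c2 gt_eqF //; lra.
- rewrite c2; apply/andP; split; nra.
Qed.

End SpecialDistances.

Section Independence.
Variable R : realType.

(** Clearing denominators, (2 (n + 1))^i 2^j = n^(i + j): if i is positive then
    n + 1 divides a power of n, and if i = 0 then n = 2. *)
Lemma space_independent (n i j : nat) : (2 < n)%N -> (0 < i + j)%N ->
  (2 + 2 / n%:R) ^+ i * (2 / n%:R) ^+ j != 1 :> R.
Proof.
move=> n2 ij; have n0 : n%:R != 0 :> R by rewrite pnatr_eq0 -lt0n (ltn_trans _ n2).
have -> : 2 + 2 / n%:R = (2 * n.+1)%:R / n%:R :> R.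
  by rewrite natrM -natr1; field.
rewrite !expr_div_n mulf_div -exprD -(inj_eq (mulIf (expf_neq0 (i + j) n0))).
rewrite divfK ?expf_neq0 // mul1r -!natrX -natrM eqr_nat.
case: i ij => [|i] ij.
  by rewrite add0n expn0 mul1n eqn_exp2r // ltn_eqF.
apply/negP => /eqP E; have : (n.+1 %| n ^ (i.+1 + j))%N.
  by rewrite -E dvdn_mulr // dvdn_exp // dvdn_mull.
have /eqP cop : coprime n.+1 (n ^ (i.+1 + j)) by rewrite coprimeXr // coprimeSn.
by move=> /gcdn_idPl; rewrite cop => -[n1]; rewrite -n1 in n2.
Qed.

Lemma plane_independent (i j : nat) : (0 < i + j)%N ->
  (11 / 3) ^+ i * (1 / 3) ^+ j != 1 :> R.
Proof.
move=> ij; have t0 : 3 != 0 :> R by rewrite pnatr_eq0.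
rewrite !expr_div_n mulf_div -exprD expr1n mulr1.
rewrite -(inj_eq (mulIf (expf_neq0 (i + j) t0))) divfK ?expf_neq0 // mul1r.
rewrite -!natrX eqr_nat; case: i ij => [|i] ij.
  by rewrite expn0 -(expn0 3) eqn_exp2l // ltn_eqF.
apply/negP => /eqP E; have : (11 %| 3 ^ (i.+1 + j))%N by rewrite -E dvdn_exp.
by rewrite Euclid_dvdX.
Qed.

End Independence.

(** * Rationality and density *)

Section DenseDistances.
Variable R : realType.

Lemma D_set_dense n (u w : R) : D_set R n u -> D_set R n w -> 1 < u -> w < 1 ->
  (forall i j, (0 < i + j)%N -> u ^+ i * w ^+ j != 1) ->
  `]0, +oo[ `<=` closure (D_set R n).
Proof.
move=> uD wD u1 w1 indep r; rewrite /= in_itv /= andbT => r0.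
have w0 : 0 < w by have /D_setP[] := wD.
(* the exponents are not both 0, so that 1 is not in S *)
pose S := [set s | exists i j, (0 < i + j)%N /\ s = u ^+ i * w ^+ j].
move=> B /nbhs_ballP[e /= e0 Be].
have [||||s [i [j [_ sE]]] rs] := @dense_semigroup R S u w _ _ _ u1 _ w0 w1 r e r0 e0.
- move=> _ _ [i [j [ij ->]]] [k [l [kl ->]]]; exists (i + k)%N, (j + l)%N.
  by rewrite !exprD mulrACA addnACA addn_gt0 ij.
- by move=> [i [j [/indep ij /esym/eqP]]]; apply/negP.
- by exists 1%N, 0%N; rewrite expr1 expr0 mulr1.
- by exists 0%N, 1%N; rewrite expr1 expr0 mul1r.
exists s; split; last by apply: Be.
by rewrite sE; apply: D_setM; apply: D_setX.
Qed.

Lemma exp_sqr_neq1 (u w U W : R) : u ^+ 2 = U -> w ^+ 2 = W ->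
  forall i j, U ^+ i * W ^+ j != 1 -> u ^+ i * w ^+ j != 1.
Proof.
move=> <- <- i j; apply: contra_neq => uw.
by rewrite -!exprM ![(2 * _)%N]mulnC !exprM -exprMn uw expr1n.
Qed.

(** A field endomorphism s applied to each coordinate transforms phi by s, so it
    preserves unit distance; it destroys the distance d if it moves d^2. *)
Lemma A_set_rational n (d : R) : (0 < n)%N -> A_set R n d ->
  exists q : rat, d ^+ 2 = ratr q.
Proof.
case: n => // n _ [d0 dA]; apply: contrapT => d_irr.
have [|s sd] := @irrational_moved _ (d ^+ 2)%:C.
  move=> q dq; apply: d_irr; exists q; apply: complexI.
  by rewrite dq -(fmorph_rat (real_complex R)).
pose f (x : 'rV[R]_n.+1) : 'rV[R[i]]_n.+1 := \row_k s (x 0 k)%:C.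
have phi_f x y : phi (f x) (f y) = s (phi (toC x) (toC y)).
  rewrite /phi rmorph_sum; apply: eq_bigr => k _.
  by rewrite !mxE rmorphXn rmorphB.
apply: sd; pose x : 'rV[R]_n.+1 := d *: delta_mx 0 0.
have phi_x : phi (toC x) (toC 0) = (d ^+ 2)%:C.
  rewrite phi_toC /sqdist (bigD1 ord0) //= big1 => [|k /negPf k0].
    by rewrite !mxE !eqxx mulr1 subr0 addr0.
  by rewrite !mxE k0 andbF mulr0 subr0 expr0n.
rewrite -phi_x -phi_f phi_x; apply: dA => // y z _ _ yz.
by rewrite phi_f yz expr1n rmorph1.
Qed.

End DenseDistances.

Theorem mainTheorem1 (R : realType) :
  (forall n : nat, (0 < n)%N ->
     A_set R n `<=` [set d : R | 0 < d /\ exists q : rat, d ^+ 2 = ratr q]) /\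
  (forall n : nat, (2 <= n)%N ->
     D_set R n `<=` `]0, +oo[ /\ `]0, +oo[ `<=` closure (D_set R n)).
Proof.
split=> [n n0 d dA|n n2].
  by split; [case: dA|apply: A_set_rational dA].
split=> [d dD|].
  by rewrite /= in_itv /= andbT; have /D_setP[] := dD.
case: n n2 => [|[|[|m]]] // _.
  have [u [w [uD wD u0 w0 [u2 w2]]]] := D_set_plane R.
  apply: (D_set_dense uD wD).
  - by nra.
  - by nra.
  - by move=> i j ij; apply: (exp_sqr_neq1 u2 w2); apply: plane_independent.
have [c cD [cE [k wD w1]]] := D_set_space R m.
apply: (D_set_dense cD wD) => //.
  by rewrite cE ltr_wpDr ?divr_ge0 ?ler0n // ltr1n.
move=> i j ij; rewrite exprMn -exprM (mulrC (_ ^+ j)) mulrA -exprD cE.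
apply: space_independent => //.
by move: ij; rewrite !addn_gt0 => /orP[->|->]; rewrite ?orbT.
Qed.
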